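(* Every hyperbolic group is weakly amenable.
   Context: Weak amenability: for a countable discrete group $\Gamma$ and a function $\varphi\colon\Gamma\to\mathbb{C}$, let $\|\varphi\|_{\mathrm{cb}}$ denote the (completely bounded) norm of the Schur multiplier on $\mathbb{B}(\ell_2\Gamma)$ associated with the kernel $k(x,y)=\varphi(x^{-1}y)$, i.e. of the map $m_k\colon [A_{x,y}]_{x,y\in\Gamma}\mapsto[\varphi(x^{-1}y)A_{x,y}]_{x,y\in\Gamma}$ on $\mathbb{B}(\ell_2\Gamma)$, where $A_{x,y}=\langle A\delta_y,\delta_x\rangle$ (for Schur multipliers the norm and the completely bounded norm coincide). The group $\Gamma$ is weakly amenable with constant $C$ if there exists a sequence of finitely supported functions $\varphi_n$ on $\Gamma$ such that $\varphi_n\to1$ pointwise and $\sup_n\|\varphi_n\|_{\mathrm{cb}}\le C$; it is weakly amenable if this holds for some constant $C<\infty$. Hyperbolic groups: a connected graph, identified with its vertex set and equipped with its graph distance $d$, is hyperbolic if there is a constant $\delta>0$ such that for every geodesic triangle (three points joined pairwise by geodesic paths) each edge is contained in the $\delta$-neighborhood $\{x : d(x,E)<\delta\}$ of the union $E$ of the other two. Here a geodesic path is a sequence $\mathfrak{p}$ of points with $d(\mathfrak{p}(m),\mathfrak{p}(n))=|m-n|$. A finitely generated group is hyperbolic if its Cayley graph (with respect to a finite generating subset; the property does not depend on the choice) is hyperbolic. *)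

(* Defs.v *)
From HB Require Import structures.
From mathcomp Require Import all_boot all_order all_algebra.
From mathcomp Require Import all_classical all_reals all_analysis.
From mathcomp Require Import complex ring.

Set Implicit Arguments.
Unset Strict Implicit.
Unset Printing Implicit Defensive.

Import Order.TTheory GRing.Theory Num.Theory.
Import numFieldNormedType.Exports.
Import ComplexField.Normc.

Local Open Scope classical_set_scope.
Local Open Scope ring_scope.

(* The complex numbers are R[i] for R : realType, with modulus                *)
(* normc : R[i] -> R.  Discrete groups are MathComp's (possibly infinite)     *)
(* groupTypes, written multiplicatively in the scope %g.                      *)

Section EllTwo.
Variables (R : realType) (X : choiceType).

Definition square_sum (f : X -> R[i]) : \bar R :=
  (\esum_(x in [set: X]) ((normc (f x)) ^+ 2)%:E)%E.

Definition square_summable : {pred X -> R[i]} :=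
  fun f => `[< (square_sum f < +oo)%E >].

Let normc_ge0 (z : R[i]) : 0 <= normc z.
Proof. by case: z => a b; exact: sqrtr_ge0. Qed.

Let sqr_normcD_le (a z w : R[i]) :
  normc (a * z + w) ^+ 2 <= (normc a ^+ 2 *+ 2) * normc z ^+ 2
                            + normc w ^+ 2 *+ 2.
Proof.
have -> : (normc a ^+ 2 *+ 2) * normc z ^+ 2 = normc (a * z) ^+ 2 *+ 2.
  by rewrite normcM exprMn mulrnAl.
apply: (@le_trans _ _ ((normc (a * z) + normc w) ^+ 2)).
  by rewrite lerXn2r ?nnegrE ?addr_ge0 ?le_normcD.
rewrite sqrrD -subr_ge0.
set u := normc _; set v := normc w.
rewrite (_ : _ - _ = (u - v) ^+ 2) ?sqr_ge0// sqrrB !mulr2n.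
by rewrite !opprD !addrA; ring.
Qed.

Let square_sum_ge0 f : (0 <= square_sum f)%E.
Proof. by apply: esum_ge0 => x _; rewrite lee_fin sqr_ge0. Qed.

Let square_sum_le (a : R[i]) (f g : X -> R[i]) :
  (square_sum (a *: f + g)%R <=
     (normc a ^+ 2 *+ 2)%:E * square_sum f + (1 *+ 2)%:E * square_sum g)%E.
Proof.
have sum_le h A : finite_set A ->
    (\sum_(x \in A) (normc (h x) ^+ 2)%:E <= square_sum h)%E.
  by move=> finA; apply: esum_ge; exists A.
apply: ge_ereal_sup => _ [A [finA _] <-].
apply: (@le_trans _ _ (\sum_(x \in A) ((normc a ^+ 2 *+ 2)%:E *
    (normc (f x) ^+ 2)%:E + (1 *+ 2)%:E * (normc (g x) ^+ 2)%:E))%E).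
  apply: lee_fsum => // x _.
  by rewrite -!EFinM -EFinD lee_fin mulr_natl sqr_normcD_le.
rewrite fsbig_split//= -!ge0_mule_fsumr; do ?by move=> x; rewrite lee_fin sqr_ge0.
by apply: leeD; apply: lee_wpmul2l;
  rewrite ?lee_fin ?mulrn_wge0 ?sqr_ge0 ?ler01 ?sum_le.
Qed.

Fact square_summable_submod : submod_closed square_summable.
Proof.
split=> [|a f g /asboolP ff /asboolP fg]; apply/asboolP.
  rewrite /square_sum esum1 ?ltry// => x _.
  by rewrite [X in normc X](_ : _ = 0)// normc0 expr0n.
apply: le_lt_trans (square_sum_le a f g) _.
have ffin h : (square_sum h < +oo)%E -> square_sum h \is a fin_num.
  by move=> hoo; rewrite ge0_fin_numE.
by rewrite -(fineK (ffin _ ff)) -(fineK (ffin _ fg)) -!EFinM -EFinD ltry.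
Qed.

HB.instance Definition _ :=
  GRing.isSubmodClosed.Build R[i] (X -> R[i]) square_summable
    square_summable_submod.

Record ell2 := Ell2 { ell2_fun :> X -> R[i] ; _ : ell2_fun \in square_summable }.

HB.instance Definition _ := [isSub for ell2_fun].
HB.instance Definition _ := [Choice of ell2 by <:].
HB.instance Definition _ := [SubChoice_isSubLmodule of ell2 by <:].

Definition ell2_norm (f : ell2) : R := Num.sqrt (fine (square_sum f)).

Fact delta_square_summable (y : X) :
  (fun x => (x == y)%:R : R[i]) \in square_summable.
Proof.
apply/asboolP; rewrite /square_sum.
rewrite (esumID [set y])// => [|x _]; last by rewrite lee_fin sqr_ge0.
rewrite setTI esum_set1 ?lee_fin ?sqr_ge0// esum1 ?adde0 ?ltry// => x [_ /= xy].
by rewrite (negbTE (introN eqP xy)) normc0 expr0n.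
Qed.

Definition ell2_delta (y : X) : ell2 := Ell2 (delta_square_summable y).

Record bounded_operator := BoundedOperator {
  bounded_operator_fun :> {linear ell2 -> ell2} ;
  _ : exists M : R, forall f : ell2,
        ell2_norm (bounded_operator_fun f) <= M * ell2_norm f }.

(* <A delta_y, delta_x> is the coordinate of A delta_y at x.                  *)
Definition entry (A : bounded_operator) (x y : X) : R[i] := A (ell2_delta y) x.

(* A matrix (A i j) of operators acts on the column vectors v of the Hilbert  *)
(* space direct sum of n copies of ell2; op_matrix_norm is its norm in        *)
(* M_n(B(ell2)) = B(ell2^n), valued in [0, +oo].                              *)
Definition column_norm n (v : 'I_n -> ell2) : R :=
  Num.sqrt (\sum_(i < n) ell2_norm (v i) ^+ 2).

Definition op_matrix_norm n (A : 'I_n -> 'I_n -> bounded_operator) : \bar R :=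
  ereal_sup [set (column_norm (fun i => \sum_(j < n) A i j (v j)))%:E
            | v in [set v : 'I_n -> ell2 | column_norm v <= 1]].

Definition map_cb_norm (m : bounded_operator -> bounded_operator) : \bar R :=
  ereal_sup [set t | exists n (A : 'I_n -> 'I_n -> bounded_operator),
                       (op_matrix_norm A <= 1)%E /\
                       t = op_matrix_norm (fun i j => m (A i j))].

Definition is_schur_multiplier (k : X -> X -> R[i])
    (m : bounded_operator -> bounded_operator) : Prop :=
  forall A x y, entry (m A) x y = k x y * entry A x y.

(* There is at most one m such that [is_schur_multiplier k m]; when there is  *)
(* none, i.e. when k does not multiply B(ell2) into itself, the norm is +oo.  *)
Definition schur_cb_norm (k : X -> X -> R[i]) : \bar R :=
  ereal_inf [set map_cb_norm m | m in is_schur_multiplier k].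

End EllTwo.

Section WeakAmenability.
Variables (R : realType) (G : groupType).

Definition group_cb_norm (phi : G -> R[i]) : \bar R :=
  schur_cb_norm (fun x y : G => phi (x^-1 * y)%g).

Definition weakly_amenable_with (C : R) : Prop :=
  exists phi : nat -> G -> R[i],
    [/\ forall n, finite_set [set x | phi n x != 0],
        forall x, (phi n x : R[i]^o) @[n --> \oo] --> (1 : R[i]^o)
      & (ereal_sup (range (fun n => group_cb_norm (phi n))) <= C%:E)%E].

Definition weakly_amenable : Prop := exists C : R, weakly_amenable_with C.

End WeakAmenability.

Section HyperbolicGraph.
Variables (R : realType) (V : eqType) (e : rel V).

Definition walk_of_length (x y : V) (n : nat) : Prop :=
  exists p : seq V, [/\ path e x p, last x p = y & size p = n].

Definition connected_graph : Prop := forall x y, exists n, walk_of_length x y n.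

(* Junk value 0 when x and y are not connected.                               *)
Definition graph_dist (x y : V) : nat :=
  xget 0%N [set n | walk_of_length x y n /\
                    forall m, walk_of_length x y m -> (n <= m)%N].

(* The path is the nonempty sequence of points x :: p.                        *)
Definition geodesic_path (x : V) (p : seq V) (y : V) : Prop :=
  last x p = y /\
  forall m n, (m <= size p)%N -> (n <= size p)%N ->
    graph_dist (nth x (x :: p) m) (nth x (x :: p) n) = `|m - n|%N.

Definition in_neighborhood (delta : R) (E : set V) (x : V) : Prop :=
  exists2 z, E z & (graph_dist x z)%:R < delta.

Definition hyperbolic_graph : Prop :=
  connected_graph /\
  exists2 delta : R, 0 < delta &
    forall x y z p q r,
      geodesic_path x p y -> geodesic_path y q z -> geodesic_path z r x ->
      let P := [set` x :: p] in let Q := [set` y :: q] in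
      let S := [set` z :: r] in
      [/\ P `<=` in_neighborhood delta (Q `|` S),
          Q `<=` in_neighborhood delta (S `|` P)
        & S `<=` in_neighborhood delta (P `|` Q)].

End HyperbolicGraph.

Section HyperbolicGroup.
Variables (R : realType) (G : groupType).

Definition sym_mem (S : seq G) (s : G) : bool := (s \in S) || (s^-1%g \in S).

Definition generates (S : seq G) : Prop :=
  forall g : G, exists2 w : seq G, all (sym_mem S) w & g = (\prod_(s <- w) s)%g.

Definition cayley_graph (S : seq G) : rel G :=
  fun x y => (x != y) && sym_mem S (x^-1 * y)%g.

Definition hyperbolic_group : Prop :=
  exists2 S : seq G, generates S & hyperbolic_graph R (cayley_graph S).

End HyperbolicGroup.

(* Main.v *)
Require Import Defs.
From HB Require Import structures.
From mathcomp Require Import all_boot all_order all_algebra.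
From mathcomp Require Import all_classical all_reals all_analysis.
From mathcomp Require Import complex zify ring lra.

Set Implicit Arguments.
Unset Strict Implicit.
Unset Printing Implicit Defensive.

Import Order.TTheory GRing.Theory Num.Theory.
Import numFieldNormedType.Exports.
Import ComplexField.Normc.

Local Open Scope ring_scope.

(** A kernel of the form k(x, y) = <xi(x), eta(y)>, where the vectors xi(x) and
eta(y) have squared norm at most C, is a Schur multiplier of cb norm at most C;
when k has finite rows, it is enough that k agrees with such a kernel on every
finite set ([schur_cb_norm_le]).  So one looks for finitely supported functions
of the word length that tend to 1 and whose kernels factor in this way with one
constant C.  The function chosen here is [tent L], the average over the square
0 <= i, j < L of the indicator function of the ball of radius i + j.

The indicator function of d(x, y) <= n is cut into pieces that see x and y
separately.  In a tree with a chosen end, d(x, y) <= n holds iff, for some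
k + l = n (up to parity), the k-th point on the ray from x to the end is the
l-th point on the ray from y.  In a hyperbolic graph the two points are replaced
by two sets of bounded size, T(x, k) and T(y, l), the points that lie roughly at
distance k, resp. l, on the way to the end ([ray_level]), and d(x, y) <= n iff
T(x, k) meets T(y, l) for some k + l = n ([ray_level_meet], [ray_level_dist]).
The end is that of an artificial ray attached to a base point, so that finite
geodesics to this base point are all that is ever used.

The number M of common points, over all k + l = n, may now exceed 1, but it is
bounded, and all the common points occur for k in a window of bounded width
([ray_level_window]).  Hence, as soon as T(x, k) meets T(y, l), M is computed
from the neighbours of k and l alone, and is given there by a kernel that
factors.  Each common point is weighted by 1/M, which is a polynomial in M
because M takes finitely many values ([reciprocal_poly]), and polynomials in
factored kernels are factored ([gram_horner]).  Thus the indicator function of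
d(x, y) <= n is the sum over k + l = n of F((x, k), (y, l)) for one factored
kernel F ([level_reciprocal]).

It remains to sum over n = i + j with (i, j) in the square.  For given k and l
the pairs (i, j) with i + j = k + l are parametrized by a shift m, namely
i = k + m - 2L and j = l - m + 2L, and the two conditions 0 <= i < L and
0 <= j < L separate k from l ([triangle_count]).  The resulting vectors are sums
over k < 2L of almost orthogonal vectors, each of which occurs for L shifts;
their squared norms are O(L^2), which the factor L^-2 of the average compensates
([gram_window], [gram_triangle]). *)

(** * Kernels that factor through bounded vectors *)

(** A finite index set is enough because a kernel on an infinite set is only
approached through factored kernels that agree with it on finite sets. *)
Definition gram (R : realFieldType) (X : Type) (C : R) (kappa : X -> X -> R) :=
  exists (I : finType) (xi eta : X -> I -> R),
    [/\ forall x y, kappa x y = \sum_i xi x i * eta y i,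
        forall x, \sum_i xi x i ^+ 2 <= C
      & forall y, \sum_i eta y i ^+ 2 <= C].

Section Gram.
Variables (R : realFieldType).
Implicit Types (X : Type) (C : R).

Lemma cauchy_schwarz_sum (I : finType) (a b : I -> R) :
  (\sum_i a i * b i) ^+ 2 <= (\sum_i a i ^+ 2) * (\sum_i b i ^+ 2).
Proof.
(* Lagrange's identity: the difference of the two sides is half of this sum. *)
have h : 0 <= \sum_i \sum_j (a i * b j - a j * b i) ^+ 2.
  by apply: sumr_ge0 => i _; apply: sumr_ge0 => j _; exact: sqr_ge0.
suff e : \sum_i \sum_j (a i * b j - a j * b i) ^+ 2 =
    ((\sum_i a i ^+ 2) * (\sum_i b i ^+ 2) - (\sum_i a i * b i) ^+ 2) *+ 2.
  by rewrite e pmulrn_lge0// subr_ge0 in h.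
rewrite (eq_bigr (fun i => \sum_j (a i ^+ 2 * b j ^+ 2 +
    b i ^+ 2 * a j ^+ 2 - ((a i * b i) * (a j * b j)) *+ 2))); last first.
  by move=> i _; apply: eq_bigr => j _; ring.
rewrite (eq_bigr (fun i => a i ^+ 2 * (\sum_j b j ^+ 2) +
    b i ^+ 2 * (\sum_j a j ^+ 2) - ((a i * b i) * (\sum_j a j * b j)) *+ 2)).
  rewrite sumrB big_split/= -!mulr_suml sumrMnl -mulr_suml; ring.
by move=> i _; rewrite sumrB big_split/= sumrMnl !mulr_sumr.
Qed.

Lemma gram_const X (c : R) : gram (1 + c ^+ 2) (fun _ _ : X => c).
Proof.
exists unit, (fun _ _ => c), (fun _ _ => 1).
split=> *; rewrite (bigD1 tt)//= big1 ?addr0 ?mulr1 ?lerDr ?ler01//; do ?by case.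
by rewrite expr1n lerDl sqr_ge0.
Qed.

Lemma gramD X C1 C2 (k1 k2 : X -> X -> R) :
  gram C1 k1 -> gram C2 k2 -> gram (C1 + C2) (fun x y => k1 x y + k2 x y).
Proof.
move=> [I1 [a1 [b1 [e1 ha1 hb1]]]] [I2 [a2 [b2 [e2 ha2 hb2]]]].
exists (I1 + I2)%type,
  (fun x i => match i with inl i => a1 x i | inr i => a2 x i end),
  (fun x i => match i with inl i => b1 x i | inr i => b2 x i end).
by split=> *; rewrite big_sumType/= ?e1 ?e2 ?lerD.
Qed.

(** The vectors of a product of kernels are tensor products. *)
Lemma gramM X C1 C2 (k1 k2 : X -> X -> R) :
  gram C1 k1 -> gram C2 k2 -> gram (C1 * C2) (fun x y => k1 x y * k2 x y).
Proof.
move=> [I1 [a1 [b1 [e1 ha1 hb1]]]] [I2 [a2 [b2 [e2 ha2 hb2]]]].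
have tensor (f1 : I1 -> R) (f2 : I2 -> R) :
    \sum_i f1 i.1 * f2 i.2 = (\sum_i f1 i) * (\sum_i f2 i).
  rewrite big_distrl/= -(pair_bigA _ (fun i j => f1 i * f2 j))/=.
  by apply: eq_bigr => i _; rewrite mulr_sumr.
exists (I1 * I2)%type, (fun x i => a1 x i.1 * a2 x i.2),
  (fun x i => b1 x i.1 * b2 x i.2); split=> [x y|x|x].
- rewrite e1 e2 -tensor; apply: eq_bigr => i _; ring.
- under eq_bigr do rewrite exprMn.
  rewrite (tensor (fun i => a1 x i ^+ 2) (fun i => a2 x i ^+ 2)).
  by apply: ler_pM => //; apply: sumr_ge0 => i _; exact: sqr_ge0.
- under eq_bigr do rewrite exprMn.
  rewrite (tensor (fun i => b1 x i ^+ 2) (fun i => b2 x i ^+ 2)).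
  by apply: ler_pM => //; apply: sumr_ge0 => i _; exact: sqr_ge0.
Qed.

Lemma gramZ X C (s : R) (k : X -> X -> R) :
  gram C k -> gram (s ^+ 2 * C) (fun x y => s ^+ 2 * k x y).
Proof.
move=> [I [a [b [e ha hb]]]].
exists I, (fun x i => s * a x i), (fun x i => s * b x i); split=> [x y|x|x].
- by rewrite e mulr_sumr; apply: eq_bigr => i _; ring.
- by under eq_bigr do rewrite exprMn; rewrite -mulr_sumr ler_wpM2l ?sqr_ge0.
- by under eq_bigr do rewrite exprMn; rewrite -mulr_sumr ler_wpM2l ?sqr_ge0.
Qed.

(** The constant for p(kappa) depends on p and on the constant of kappa only;
this uniformity is what makes the bounds below independent of the finite set and
of the scale. *)
Lemma gram_horner (p : {poly R}) C : exists C', forall X (k : X -> X -> R),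
  gram C k -> gram C' (fun x y => p.[k x y]).
Proof.
elim/poly_ind: p => [|p c [C' IH]].
  exists (1 + 0 ^+ 2) => X k _.
  have [I [a [b [e ha hb]]]] := gram_const X 0.
  by exists I, a, b; split=> // x y; rewrite horner0 -e.
exists (C' * C + (1 + c ^+ 2)) => X k gk.
have [I [a [b [e ha hb]]]] := gramD (gramM (IH _ _ gk) gk) (gram_const X c).
by exists I, a, b; split=> // x y; rewrite -e !hornerE.
Qed.

(** The polynomial 1 - prod_i (1 - X / i), over 1 <= i <= n, vanishes at 0 and is
1 at 1, ..., n; its quotient by X interpolates 1/t at these points. *)
Lemma reciprocal_poly n : exists g : {poly R},
  forall t, (0 < t <= n)%N -> t%:R * g.[t%:R] = 1.
Proof.
pose p : {poly R} := 1 - \prod_(i < n) (1 - i.+1%:R^-1 *: 'X).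
have /factor_theorem[g pg] : root p 0.
  rewrite rootE !hornerE horner_prod big1 ?subrr// => i _.
  by rewrite !hornerE subr0.
exists g => t; case/andP=> t0 tn.
have pt : p.[t%:R] = 1.
  have tn' : (t.-1 < n)%N by lia.
  rewrite !hornerE horner_prod (bigD1 (Ordinal tn'))//= !hornerE prednK//.
  rewrite mulVf ?subrr ?mul0r ?subr0//; last by rewrite pnatr_eq0; lia.
by rewrite -[RHS]pt pg !hornerE subr0 mulrC.
Qed.
End Gram.

(** * Superposition of almost orthogonal vectors *)

Section Window.

Lemma leq_sum_window (P : pred nat) n c :
  (forall k k', P k -> P k' -> (k' <= k + c)%N) -> (\sum_(k < n) P k <= c.+1)%N.
Proof.
move=> hP; rewrite -(big_mkord xpredT (fun k => nat_of_bool (P k))).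
rewrite -big_mkcond/= sum1_count -size_filter.
have [/hasP[k0 _ Pk0]|] := boolP (has P (index_iota 0 n)); last first.
  by rewrite has_count -size_filter; lia.
have exP : exists k, P k by exists k0.
case: (ex_minnP exP) => a Pa mina.
rewrite -(size_iota a c.+1); apply: uniq_leq_size => [|k].
  by rewrite filter_uniq ?iota_uniq.
rewrite mem_filter mem_iota => /andP[Pk _].
by have := mina _ Pk; have := hP _ _ Pa Pk; lia.
Qed.

Variable R : realFieldType.

Lemma sqr_natb (b : bool) : (b%:R : R) ^+ 2 = b%:R.
Proof. by case: b; rewrite ?expr1n ?expr0n. Qed.

(** For each i at most e of the n vectors a k occur in the inner sum, so its
square is at most e times the sum of the squares; each k is then counted for at
most v values of j and r values of i. *)
Lemma window_bound (n v e r : nat) (C : R) (J I S : finType)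
    (P : J -> 'I_n -> bool) (tau : 'I_n -> I -> bool) (a : 'I_n -> S -> R) :
  (forall k, \sum_j P j k <= v)%N ->
  (forall k, \sum_i tau k i <= r)%N ->
  (forall i, \sum_k tau k i <= e)%N ->
  (forall k, \sum_s a k s ^+ 2 <= C) ->
  \sum_(t : J * I * S)
     (\sum_k (P t.1.1 k && tau k t.1.2)%:R * a k t.2) ^+ 2
  <= e%:R * (n%:R * (v%:R * r%:R * C)).
Proof.
move=> hP hr he ha.
have -> : e%:R * (n%:R * (v%:R * r%:R * C)) =
    \sum_(k < n) e%:R * (v%:R * r%:R * C).
  by rewrite sumr_const card_ord -mulr_natl; ring.
apply: (@le_trans _ _ (\sum_(t : J * I * S) e%:R *
    \sum_k (P t.1.1 k)%:R * (tau k t.1.2)%:R * a k t.2 ^+ 2)).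
  apply: ler_sum => -[[j i] s] _ /=.
  have -> : \sum_k (P j k && tau k i)%:R * a k s =
      \sum_k (tau k i)%:R * ((P j k && tau k i)%:R * a k s) :> R.
    by apply: eq_bigr => k _; case: (tau k i); rewrite ?andbF ?(mul0r, mul1r).
  apply: le_trans (cauchy_schwarz_sum _ _) _.
  rewrite (eq_bigr _ (fun k _ => sqr_natb (tau k i))) -natr_sum.
  have -> : \sum_k ((P j k && tau k i)%:R * a k s) ^+ 2 =
      \sum_k (P j k)%:R * (tau k i)%:R * a k s ^+ 2.
    by apply: eq_bigr => k _; rewrite exprMn sqr_natb -mulnb natrM.
  apply: ler_wpM2r; last by rewrite ler_nat.
  by apply: sumr_ge0 => k _; apply: mulr_ge0; rewrite ?sqr_ge0 ?mulr_ge0 ?ler0n.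
rewrite -mulr_sumr exchange_big/= mulr_sumr.
apply: ler_sum => k _; apply: ler_wpM2l; first exact: ler0n.
rewrite -(pair_bigA _ (fun p s => (P p.1 k)%:R * (tau k p.2)%:R * a k s ^+ 2))/=.
rewrite -(pair_bigA _ (fun j i => \sum_s (P j k)%:R * (tau k i)%:R * a k s ^+ 2))/=.
have -> : \sum_j \sum_i \sum_s (P j k)%:R * (tau k i)%:R * a k s ^+ 2 =
    (\sum_j P j k)%:R * (\sum_i tau k i)%:R * \sum_s a k s ^+ 2.
  rewrite !natr_sum !mulr_suml; apply: eq_bigr => j _.
  rewrite -mulrA mulr_suml mulr_sumr; apply: eq_bigr => i _.
  by rewrite mulrA mulr_sumr.
apply: ler_pM; rewrite ?mulr_ge0 ?ler0n//; last first.
  by rewrite ler_pM ?ler0n ?ler_nat.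
by apply: sumr_ge0 => s _; exact: sqr_ge0.
Qed.

(** The kernel kappa lives on pairs (point, level).  The conditions P and Q on
the levels of x and of y are tied together by the common shift j only, and the
conditions tau by the common index i only, so that the double sum over the
levels is again a scalar product. *)
Lemma gram_window (X : Type) (n v e r : nat) (C : R) (J I : finType)
    (P Q : J -> 'I_n -> bool) (tau : X -> 'I_n -> I -> bool)
    (kappa : X * nat -> X * nat -> R) :
  (forall k, \sum_j P j k <= v)%N ->
  (forall k, \sum_j Q j k <= v)%N ->
  (forall x k, \sum_i tau x k i <= r)%N ->
  (forall x i, \sum_k tau x k i <= e)%N ->
  gram C kappa ->
  gram (e%:R * (n%:R * (v%:R * r%:R * C))) (fun x y =>
    \sum_(k < n) \sum_(l < n) (\sum_j (P j k && Q j l))%:R *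
      (\sum_i (tau x k i && tau y l i))%:R * kappa (x, k : nat) (y, l : nat)).
Proof.
move=> hP hQ hr he [S [a [b [eab ha hb]]]].
exists (J * I * S)%type,
  (fun x t => \sum_k (P t.1.1 k && tau x k t.1.2)%:R * a (x, k : nat) t.2),
  (fun y t => \sum_k (Q t.1.1 k && tau y k t.1.2)%:R * b (y, k : nat) t.2).
split=> [x y|x|y]; last 2 first.
- exact: (window_bound hP (hr x) (he x) (fun k => ha (x, k : nat))).
- exact: (window_bound hQ (hr y) (he y) (fun k => hb (y, k : nat))).
transitivity (\sum_(t : J * I * S) \sum_(k < n) \sum_(l < n)
  ((P t.1.1 k && Q t.1.1 l)%:R * (tau x k t.1.2 && tau y l t.1.2)%:R *
   (a (x, k : nat) t.2 * b (y, l : nat) t.2))); last first.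
  apply: eq_bigr => t _; rewrite mulr_suml; apply: eq_bigr => k _.
  rewrite mulr_sumr; apply: eq_bigr => l _.
  by rewrite -!mulnb !natrM; ring.
rewrite [RHS]exchange_big/=; apply: eq_bigr => k _.
rewrite [RHS]exchange_big/=; apply: eq_bigr => l _.
rewrite -(pair_bigA _ (fun p s => (P p.1 k && Q p.1 l)%:R *
  (tau x k p.2 && tau y l p.2)%:R * (a (x, k : nat) s * b (y, l : nat) s)))/=.
rewrite eab !natr_sum.
rewrite -(pair_bigA _ (fun j i => \sum_s (P j k && Q j l)%:R *
  (tau x k i && tau y l i)%:R * (a (x, k : nat) s * b (y, l : nat) s)))/=.
rewrite !mulr_suml; apply: eq_bigr => j _.
rewrite -mulrA mulr_suml mulr_sumr; apply: eq_bigr => i _.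
by rewrite mulrA mulr_sumr.
Qed.

End Window.

(** * Counting common points of level sets *)

(** The set T x a stands for the points of level a - c on the way from x to the
chosen end; the shift by c keeps the indices natural numbers when a level is
compared with the c levels on either side of it.  The hypotheses are all that the
geometry contributes to the analytic argument. *)
Section LevelSets.
Variables (X Z : eqType) (D : X -> X -> nat).
Variables (T : X -> nat -> pred Z) (cover : X -> nat -> seq Z) (c r : nat).

Hypothesis T_cover : forall x a z, T x a z -> z \in cover x a.
Hypothesis size_cover : forall x a, (size (cover x a) <= r)%N.
Hypothesis T_low : forall x a z, T x a z -> (c <= a)%N.
Hypothesis T_level : forall x a a' z, T x a z -> T x a' z -> (a' <= a + c)%N.
Hypothesis T_dist : forall x y a b z,
  T x a z -> T y b z -> (D x y + 2 * c <= a + b)%N.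
Hypothesis T_window : forall x y a b z a' b' z',
  T x a z -> T y b z -> T x a' z' -> T y b' z' -> (a + b = a' + b')%N ->
  (a' <= a + c)%N.
Hypothesis T_meet : forall x y n, (D x y <= n)%N ->
  exists a b z, [/\ (a + b = n + 2 * c)%N, T x a z & T y b z].

Section Support.
Variable W : seq Z.
Hypothesis uniqW : uniq W.

Definition meet x a y b : nat := \sum_(z <- W) (T x a z && T y b z).

(** For p = (x, k) and q = (y, l), the common points of T x a and T y b where
a + b = k + l + 2c and a is within c of k + c.  The index j is a parameter of the
vectors: it moves p up and q down, so p and q need not know k + l. *)
Definition near_meet (p q : X * nat) : nat :=
  \sum_(j < (2 * c).+1) meet p.1 (p.2 + j) q.1 (q.2 + (2 * c - j)).

Lemma meet_gt0P x a y b :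
  reflect (exists z, [/\ z \in W, T x a z & T y b z]) (0 < meet x a y b)%N.
Proof.
rewrite /meet lt0n sum_nat_seq_neq0; apply: (iffP hasP) => [[z zW /=]|[z [zW xz yz]]].
  by case: (boolP (_ && _)) => // /andP[xz yz] _; exists z.
by exists z => //=; rewrite xz yz.
Qed.

Lemma sum_T_le x a : (\sum_(z <- W) T x a z <= r)%N.
Proof.
apply: leq_trans (size_cover x a).
rewrite -big_mkcond/= sum1_count -size_filter uniq_leq_size ?filter_uniq// => z.
by rewrite mem_filter => /andP[/T_cover].
Qed.

Lemma meet_le x a y b : (meet x a y b <= r)%N.
Proof.
apply: leq_trans (sum_T_le x a); apply: leq_sum => z _.
by case: (T x a z); rewrite ?leq_b1.
Qed.

Lemma near_meet_le p q : (near_meet p q <= (2 * c).+1 * r)%N.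
Proof.
rewrite -[X in (X * r)%N]card_ord -sum_nat_const.
by apply: leq_sum => j _; exact: meet_le.
Qed.

Section Level.
Variables (x y : X) (n : nat).
Let m a := meet x a y (n + 2 * c - a).
Let M := (\sum_(0 <= a < (n + 2 * c).+1) m a)%N.

Let m_gt0 a : (a <= n + 2 * c)%N -> (0 < m a)%N -> (c <= a <= n + c)%N.
Proof. by move=> an /meet_gt0P[z [_ /T_low h1 /T_low h2]]; lia. Qed.

(** If level k contains a common point then every other one lies within c of
it, so the local count at k is the global count. *)
Lemma near_meet_const k : (k <= n)%N ->
  (0 < meet x (k + c) y (n - k + c))%N ->
  near_meet (x, k) (y, n - k)%N = M.
Proof.
move=> kn /meet_gt0P[z [zW xz yz]].
have m0 a : (a <= n + 2 * c)%N -> ~~ (k <= a < k + (2 * c).+1)%N -> m a = 0%N.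
  move=> an out; apply/eqP; rewrite -leqn0 leqNgt; apply/negP.
  move=> /meet_gt0P[z' [_ xz' yz']].
  have h1 := T_window xz yz xz' yz' ltac:(lia).
  have h2 := T_window xz' yz' xz yz ltac:(lia).
  by move: out; lia.
rewrite /M (@big_cat_nat _ _ _ k)/=; [|lia|lia].
rewrite (@big_cat_nat _ _ _ (k + (2 * c).+1) k)/=; [|lia|lia].
rewrite big_nat big1 ?add0n; last by move=> a ?; apply: m0; lia.
rewrite [X in (_ + X)%N]big_nat [X in (_ + X)%N]big1 ?addn0; last first.
  by move=> a ?; apply: m0; lia.
rewrite -[X in index_iota X (k + _)]add0n big_addn addKn big_mkord /near_meet/=.
apply: eq_bigr => j _; rewrite /m addnC; congr meet.
by have := ltn_ord j; lia.
Qed.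

Lemma level_sum : (\sum_(k < n.+1) meet x (k + c) y (n - k + c))%N = M.
Proof.
have m0 a : (a <= n + 2 * c)%N -> ~~ (c <= a < n.+1 + c)%N -> m a = 0%N.
  move=> an out; apply/eqP; rewrite -leqn0 leqNgt; apply/negP => /(m_gt0 an).
  by move: out; lia.
rewrite /M (@big_cat_nat _ _ _ c)/=; [|lia|lia].
rewrite (@big_cat_nat _ _ _ (n.+1 + c) c)/=; [|lia|lia].
rewrite [X in _ = (X + _)%N]big_nat [X in _ = (X + _)%N]big1 ?add0n; last first.
  by move=> a ?; apply: m0; lia.
rewrite [X in _ = (_ + X)%N]big_nat [X in _ = (_ + X)%N]big1 ?addn0; last first.
  by move=> a ?; apply: m0; lia.
rewrite -[X in index_iota X (n.+1 + c)]add0n big_addn addnK big_mkord; apply: eq_bigr => k _.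
by rewrite /m; congr meet; have := ltn_ord k; lia.
Qed.

Hypothesis subW : forall a z, (a <= n + 2 * c)%N -> T x a z -> z \in W.

Lemma level_gt0 : (0 < M)%N = (D x y <= n)%N.
Proof.
apply/idP/idP => [|/T_meet[a [b [z [ab xz yz]]]]].
  rewrite /M lt0n sum_nat_seq_neq0 => /hasP[a].
  rewrite mem_index_iota => /andP[_ an] /=; rewrite -lt0n.
  by move=> /meet_gt0P[z [_ xz yz]]; have := T_dist xz yz; lia.
rewrite /M lt0n sum_nat_seq_neq0; apply/hasP; exists a.
  by rewrite mem_index_iota; lia.
rewrite /= -lt0n; apply/meet_gt0P; exists z; split=> //.
  by apply: subW xz; lia.
by rewrite -ab addKn.
Qed.

(** Each of the M common points receives the weight 1/M, which the function g
computes from the local count. *)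
Lemma level_reciprocal (R : realFieldType) (g : R -> R) :
  (forall t, (0 < t <= (2 * c).+1 * r)%N -> t%:R * g t%:R = 1) ->
  \sum_(k < n.+1) (meet x (k + c) y (n - k + c))%:R *
    g (near_meet (x, k : nat) (y, n - k)%N)%:R = (D x y <= n)%:R.
Proof.
move=> hg.
transitivity (\sum_(k < n.+1) (meet x (k + c) y (n - k + c))%:R * g M%:R).
  apply: eq_bigr => k _.
  have [->|m0] := posnP (meet x (k + c) y (n - k + c)); first by rewrite !mul0r.
  by rewrite near_meet_const// -ltnS ltn_ord.
rewrite -mulr_suml -natr_sum level_sum -level_gt0.
have [->|M0] := posnP M; first by rewrite mul0r.
rewrite hg// M0/=.
have [k k0] : exists k : 'I_n.+1, (0 < meet x (k + c) y (n - k + c))%N.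
  apply/existsP; move: M0; rewrite -level_sum lt0n sum_nat_eq0 negb_forall.
  by under eq_existsb do rewrite /= -lt0n.
rewrite -(near_meet_const _ k0) ?near_meet_le//.
by rewrite -ltnS ltn_ord.
Qed.
End Level.

(** The vector at (x, k) is the indicator function of the disjoint union of the
2c + 1 sets T x (k + j); its squared norm is the number of their points. *)
Lemma gram_near_meet (R : realFieldType) :
  gram (((2 * c).+1 * r)%:R : R) (fun p q => (near_meet p q)%:R).
Proof.
pose J := ('I_(2 * c).+1 * 'I_(size W))%type.
exists J, (fun p (t : J) => (T p.1 (p.2 + t.1) (tnth (in_tuple W) t.2))%:R),
  (fun q (t : J) => (T q.1 (q.2 + (2 * c - t.1)) (tnth (in_tuple W) t.2))%:R).
have bound (x : X) (a : 'I_(2 * c).+1 -> nat) :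
    \sum_(t : J)
      ((T x (a t.1) (tnth (in_tuple W) t.2))%:R : R) ^+ 2
    <= ((2 * c).+1 * r)%:R.
  rewrite (eq_bigr _ (fun t _ => sqr_natb R _)) -natr_sum ler_nat.
  rewrite -(pair_bigA _ (fun j i => nat_of_bool
    (T x (a j) (tnth (in_tuple W) i))))/=.
  rewrite -[X in (X * r)%N]card_ord -sum_nat_const.
  apply: leq_sum => j _; apply: leq_trans (sum_T_le x (a j)).
  by rewrite (big_tnth _ _ W).
split=> [p q|p|q]; last 2 first.
- exact: (bound p.1 (fun j => p.2 + j)%N).
- exact: (bound q.1 (fun j => q.2 + (2 * c - j))%N).
rewrite /near_meet natr_sum -(pair_bigA _ (fun (j : 'I__) (i : 'I__) =>
  (T p.1 (p.2 + j) (tnth (in_tuple W) i))%:R *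
  (T q.1 (q.2 + (2 * c - j)) (tnth (in_tuple W) i))%:R))/=.
apply: eq_bigr => j _; rewrite /meet natr_sum (big_tnth _ _ W).
by apply: eq_bigr => i _; rewrite -mulnb natrM.
Qed.

End Support.

(** The bijection is i = k + j - 2L, i' = l - j + 2L; the two conditions on j say
that 0 <= i < L and 0 <= i' < L. *)
Lemma triangle_count L k l : (k < 2 * L)%N -> (l < 2 * L)%N ->
  (\sum_(j < 3 * L) ((2 * L <= k + j < 3 * L) && (l + L < j <= l + 2 * L)) =
   \sum_(i < L) \sum_(i' < L) (i + i' == k + l))%N.
Proof.
move=> kL lL.
rewrite -(big_mkord xpredT (fun j => nat_of_bool
  ((2 * L <= k + j < 3 * L) && (l + L < j <= l + 2 * L))%N)).
rewrite (@big_cat_nat _ _ _ (2 * L - k))/=; [|lia|lia].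
rewrite (@big_cat_nat _ _ _ (L + (2 * L - k)) (2 * L - k))/=; [|lia|lia].
rewrite big_nat big1 ?add0n; last by move=> j ?; lia.
rewrite [X in (_ + X)%N]big_nat [X in (_ + X)%N]big1 ?addn0; last first.
  by move=> j ?; lia.
rewrite -[X in index_iota X (L + _)]add0n big_addn addnK big_mkord.
apply: eq_bigr => i _; have iL := ltn_ord i.
have [n_big|n_small] := boolP (i <= k + l < i + L)%N; last first.
  rewrite big1 => [|i' _]; last by have := ltn_ord i'; lia.
  by move: n_small; lia.
have n_lt : (k + l - i < L)%N by lia.
rewrite (bigD1 (Ordinal n_lt))//= big1 ?addn0 => [|i' /eqP ne].
  by rewrite subnKC ?eqxx; lia.
apply/eqP; rewrite eqb0; apply/eqP => e; apply: ne; apply: val_inj => /=.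
by lia.
Qed.

Lemma antidiagonal_sum (R : realFieldType) N n (F : nat -> nat -> R) :
  (n < N)%N ->
  \sum_(k < N) \sum_(l < N) (n == k + l)%N%:R * F k l =
  \sum_(k < n.+1) F k (n - k)%N.
Proof.
move=> nN; rewrite (big_ord_widen N (fun k => F k (n - k)%N))//.
rewrite [RHS]big_mkcond/=; apply: eq_bigr => k _; rewrite ltnS.
case: leqP => [kn|nk]; last first.
  by apply: big1 => l _; rewrite (_ : _ == _ = false) ?mul0r//; lia.
have lN : (n - k < N)%N by lia.
rewrite (bigD1 (Ordinal lN))//= big1 ?addr0 => [|l /eqP ne].
  by rewrite subnKC// eqxx mul1r.
rewrite (_ : _ == _ = false) ?mul0r//; apply/negP => /eqP e.
by apply: ne; apply: val_inj => /=; lia.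
Qed.

(** Here n = 2L levels, v = L shifts, sets of size at most r and overlap at most
c + 1 give the factor (c + 1) * 2L * L * r in the window estimate, and the factor
2L * L is removed by L^-2. *)
Lemma gram_triangle (R : realFieldType) : exists C : R, forall L (F : seq X),
  (0 < L)%N -> exists2 kappa, gram C kappa &
  {in F &, forall x y, kappa x y =
     L%:R^-1 ^+ 2 * \sum_(i < L) \sum_(j < L) (D x y <= i + j)%N%:R}.
Proof.
have [g hg] := reciprocal_poly R ((2 * c).+1 * r).
have [C' hC'] := gram_horner g ((2 * c).+1 * r)%:R.
exists (c.+1%:R * (2 * (r%:R * C'))) => L F L0.
(* The finite set W contains all the points that matter for x, y in F. *)
pose W := undup (flatten [seq cover x a | x <- F, a <- iota 0 (2 * L + 2 * c)]).
have uW : uniq W by exact: undup_uniq.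
have subW x a z : x \in F -> (a < 2 * L + 2 * c)%N -> T x a z -> z \in W.
  move=> xF aL /T_cover zx; rewrite mem_undup; apply/flattenP.
  exists (cover x a) => //; apply/allpairsP; exists (x, a).
  by rewrite /= mem_iota.
pose P (j : 'I_(3 * L)) (k : 'I_(2 * L)) := (2 * L <= k + j < 3 * L)%N.
pose Q (j : 'I_(3 * L)) (l : 'I_(2 * L)) := (l + L < j <= l + 2 * L)%N.
pose tau x (k : 'I_(2 * L)) i := T x (k + c) (tnth (in_tuple W) i).
have hP k : (\sum_j P j k <= L)%N.
  rewrite -[X in (_ <= X)%N]prednK//.
  by apply: (@leq_sum_window (fun j => 2 * L <= k + j < 3 * L)%N); lia.
have hQ k : (\sum_j Q j k <= L)%N.
  rewrite -[X in (_ <= X)%N]prednK//.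
  by apply: (@leq_sum_window (fun j => k + L < j <= k + 2 * L)%N); lia.
have hr x k : (\sum_i tau x k i <= r)%N.
  by have := sum_T_le uW x (k + c); rewrite (big_tnth _ _ W).
have he x i : (\sum_k tau x k i <= c.+1)%N.
  apply: (@leq_sum_window (fun k => T x (k + c) (tnth (in_tuple W) i))).
  by move=> k k' h1 h2; have := T_level h1 h2; lia.
have gg := gram_window hP hQ hr he (hC' _ _ (gram_near_meet uW R)).
have := gramZ L%:R^-1 gg.
have -> : L%:R^-1 ^+ 2 * (c.+1%:R * ((2 * L)%:R * (L%:R * r%:R * C'))) =
   c.+1%:R * (2 * (r%:R * C')) :> R.
  by rewrite natrM; field; rewrite pnatr_eq0 -lt0n.
move=> gK; eexists; first exact: gK.
move=> x y xF yF /=; congr (_ * _).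
pose G k l : R := (meet W x (k + c) y (l + c))%:R *
    g.[(near_meet W (x, k) (y, l))%:R].
transitivity (\sum_(k < 2 * L) \sum_(l < 2 * L) \sum_(i < L) \sum_(j < L)
    (i + j == k + l)%N%:R * G k l).
  apply: eq_bigr => k _; apply: eq_bigr => l _.
  rewrite triangle_count ?ltn_ord// -mulrA.
  have -> : (\sum_i (tau x k i && tau y l i))%:R *
      g.[(near_meet W (x, k : nat) (y, l : nat))%:R] = G k l.
    by rewrite /G /meet (big_tnth _ _ W).
  rewrite natr_sum mulr_suml.
  by apply: eq_bigr => i _; rewrite natr_sum mulr_suml.
transitivity (\sum_(i < L) \sum_(j < L) \sum_(k < 2 * L) \sum_(l < 2 * L)
    (i + j == k + l)%N%:R * G k l).
  transitivity (\sum_(i < L) \sum_(k < 2 * L) \sum_(l < 2 * L) \sum_(j < L)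
      (i + j == k + l)%N%:R * G k l).
    rewrite [RHS]exchange_big; apply: eq_bigr => k _.
    by rewrite [RHS]exchange_big.
  apply: eq_bigr => i _; rewrite [RHS]exchange_big; apply: eq_bigr => k _.
  by rewrite [RHS]exchange_big.
apply: eq_bigr => i _; apply: eq_bigr => j _.
have ijL : (i + j < 2 * L)%N by have := ltn_ord i; have := ltn_ord j; lia.
rewrite (antidiagonal_sum G ijL) /G.
apply: (@level_reciprocal W uW x y (i + j) _ R (fun t => g.[t])) => // a z an.
by apply: subW; lia.
Qed.

End LevelSets.

(** * Level sets in a hyperbolic metric space *)

Section HyperbolicMetric.
Variables (X : choiceType) (d : X -> X -> nat) (o : X) (delta : nat).

Hypothesis dxx : forall x, d x x = 0%N.
Hypothesis dC : forall x y, d x y = d y x.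
Hypothesis dT : forall y x z, (d x z <= d x y + d y z)%N.
Hypothesis interpolation : forall x y t, (t <= d x y)%N ->
  exists2 z, d x z = t & d z y = (d x y - t)%N.
(** Thin triangles: equality in the triangle inequality says that a point lies
on some geodesic between the two others. *)
Hypothesis thin : forall x y z v, (d x v + d v y = d x y)%N ->
  exists2 u, (d v u <= delta)%N &
    (d x u + d u z = d x z \/ d y u + d u z = d y z)%N.

(** On a geodesic from x to y, the last point v that is close to [x, o] is
followed by a point close to [y, o]; so v is close to both. *)
Lemma triangle_center x y : exists u,
  [/\ (d x u + d u y = d x y)%N, (d x u + d u o <= d x o + 2 * delta.+1)%N
    & (d y u + d u o <= d y o + 2 * delta.+1)%N].
Proof.
pose P t := `[< exists2 v, (d x v = t /\ d x v + d v y = d x y)%N &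
  exists2 u, (d v u <= delta)%N & (d x u + d u o = d x o)%N >].
have exP : exists t, P t.
  exists 0%N; apply/asboolP; exists x; first by rewrite dxx.
  by exists x; rewrite dxx.
have ubP t : P t -> (t <= d x y)%N by move=> /asboolP[v [<- <-] _]; lia.
case: (ex_maxnP exP ubP) => t /asboolP[v [xv vy] [u vu uo]] maxt.
have xvo : (d x v + d v o <= d x o + 2 * delta)%N.
  by have := dT u x v; have := dT u v o; rewrite (dC u v); lia.
exists v; split=> //; first lia.
have [v_y|v_lt] := posnP (d v y).
  by have := dT y v o; rewrite (dC y v); lia.
have [v' vv' v'y] := interpolation v_lt.
have xv' : d x v' = t.+1 by have := dT v x v'; have := dT v' x y; lia.
have v'_btw : (d x v' + d v' y = d x y)%N by lia.
have [u' v'u' [xu'|yu']] := thin o v'_btw.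
  have /maxt : P t.+1 by apply/asboolP; exists v' => //; exists u'.
  by rewrite ltnn.
have vu' : (d v u' <= delta.+1)%N by have := dT v' v u'; lia.
by have := dT u' y v; have := dT u' v o; rewrite (dC u' v); lia.
Qed.

Let c := (2 * delta + 3)%N.

(** A ray is attached to the space at o: the pair (w, 0) is the point w, and
(o, s) is the point of the ray at distance s from o.  The point z = (w, s) has
distance d x w + s from x, and d w o - s is its height above o, which decreases to
minus infinity along the ray.  The level k = a - c contains z when its distance
from x is at most k and its height is at most d x o - k + c: up to an error c, z
is at distance k from x on a geodesic ray from x through o. *)
Definition ray_level (x : X) (a : nat) : pred (X * nat) := fun z =>
  [&& (z.2 == 0%N) || (z.1 == o), (d x z.1 + z.2 + c <= a)%N
    & (d z.1 o + a <= d x o + z.2 + 2 * c)%N].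

Lemma ray_level_low x a z : ray_level x a z -> (c <= a)%N.
Proof. by case/and3P; lia. Qed.

Lemma ray_level_level x a a' z :
  ray_level x a z -> ray_level x a' z -> (a' <= a + c)%N.
Proof.
by move=> /and3P[_ h1 h2] /and3P[_ h3 h4]; have := dT z.1 x o; lia.
Qed.

Lemma ray_level_dist x y a b z :
  ray_level x a z -> ray_level y b z -> (d x y + 2 * c <= a + b)%N.
Proof.
move=> /and3P[_ h1 h2] /and3P[_ h3 h4].
by have := dT z.1 x y; rewrite (dC z.1 y); lia.
Qed.

(** If z has height h then a + h lies between d x o + c and d x o + 2c, and
b + h between d y o + c and d y o + 2c.  Hence a - b lies in an interval of
length 2c that depends on x and y only, and so a lies in one of length c once
a + b is given. *)
Lemma ray_level_window x y a b z a' b' z' :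
  ray_level x a z -> ray_level y b z ->
  ray_level x a' z' -> ray_level y b' z' -> (a + b = a' + b')%N ->
  (a' <= a + c)%N.
Proof.
move=> /and3P[_ h1 h2] /and3P[_ h3 h4] /and3P[_ h5 h6] /and3P[_ h7 h8].
have := dT z.1 x o; have := dT z.1 y o; have := dT z'.1 x o.
by have := dT z'.1 y o; lia.
Qed.

(** Let u be a center of the triangle x, y, o.  A point reached from u by t steps
towards o, and then along the ray, has distance d x u + t from x and d y u + t
from y, up to a bounded error; t is chosen such that the sum of these distances is
n or n - 1. *)
Lemma ray_level_meet x y n : (d x y <= n)%N -> exists a b z,
  [/\ (a + b = n + 2 * c)%N, ray_level x a z & ray_level y b z].
Proof.
move=> xyn; have [u [uxy ux uy]] := triangle_center x y.
pose t := ((n - d x y) %/ 2)%N.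
have tn : (d x y + 2 * t <= n <= d x y + 2 * t + 1)%N by rewrite /t; lia.
exists (d x u + t + c)%N, (n - (d x u + t) + c)%N.
have := dT u x o; have := dT u y o; rewrite (dC u y) in uxy.
case: (leqP t (d u o)) => [tuo|uot] h1 h2.
  have [w uw wo] := interpolation tuo; exists (w, 0%N).
  have := dT u x w; have := dT u y w; have := dT w x o; have := dT w y o.
  by rewrite /ray_level/= => *; split; rewrite /c; lia.
exists (o, (t - d u o)%N); rewrite /ray_level/= eqxx orbT dxx/=.
by split; rewrite /c; lia.
Qed.

Variables (b : nat -> nat) (ball : nat -> X -> seq X).
Hypothesis mem_ball : forall n x y, (d x y <= n)%N -> y \in ball n x.
Hypothesis size_ball : forall n x, (size (ball n x) <= b n)%N.

(** By thinness, the points of level a - c lie in a ball around the point v at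
distance a - c from x on a geodesic from x to o (around o when this geodesic is
too short); the points of the ray form an interval. *)
Lemma ray_level_cover x a : exists s : seq (X * nat),
  (size s <= b (2 * delta + c) + c.+1)%N /\ forall z, ray_level x a z -> z \in s.
Proof.
have [v hv] : exists v, forall w, (d x w + c <= a)%N ->
    (d w o + a <= d x o + 2 * c)%N -> (d v w <= 2 * delta + c)%N.
  case: (leqP (a - c) (d x o)) => [kx|xk]; last first.
    by exists o => w h1 h2; rewrite dC; lia.
  have [v xv vo] := interpolation kx; exists v => w h1 h2.
  have v_btw : (d x v + d v o = d x o)%N by lia.
  have [u vu [xu|ou]] := thin w v_btw.
    by have := dT u v w; have := dT u x v; rewrite (dC u v); lia.
  have := dT u v w; have := dT u v o; rewrite (dC w o) in h2.
  by rewrite (dC u o); lia.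
exists ([seq (w, 0%N) | w <- ball (2 * delta + c) v] ++
  [seq (o, s) | s <- iota (a - d x o - 2 * c) c.+1]); split.
  by rewrite size_cat !size_map size_iota leq_add2r.
move=> [w s] /and3P[/= /orP[/eqP->|/eqP->] h1 h2]; rewrite mem_cat.
  apply/orP; left; apply: (map_f (fun w => (w, 0%N))).
  by apply: mem_ball; apply: hv; lia.
apply/orP; right; rewrite -map_cons -/(iota _ c.+1); apply: (map_f (pair o)).
by rewrite mem_iota; rewrite dxx in h2; lia.
Qed.

Lemma gram_hyperbolic (R : realFieldType) : exists C : R,
  forall L (F : seq X), (0 < L)%N -> exists2 kappa, gram C kappa &
  {in F &, forall x y, kappa x y =
     L%:R^-1 ^+ 2 * \sum_(i < L) \sum_(j < L) (d x y <= i + j)%N%:R}.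
Proof.
have [cover hcover] := choice (fun p : X * nat => ray_level_cover p.1 p.2).
apply: (@gram_triangle X (X * nat)%type d ray_level
  (fun x a => cover (x, a)) c (b (2 * delta + c) + c.+1)).
- by move=> x a; exact: (hcover (x, a)).2.
- by move=> x a; exact: (hcover (x, a)).1.
- exact: ray_level_low.
- exact: ray_level_level.
- exact: ray_level_dist.
- exact: ray_level_window.
- exact: ray_level_meet.
Qed.

End HyperbolicMetric.

(** * Graphs and Cayley graphs as metric spaces *)

Section GraphMetric.
Variables (V : choiceType) (e : rel V).
Hypothesis sym_e : symmetric e.
Hypothesis conn : connected_graph e.

Local Notation d := (graph_dist e).

Lemma graph_distP x y : walk_of_length e x y (d x y) /\
  forall m, walk_of_length e x y m -> (d x y <= m)%N.
Proof.
have [n wn] := conn x y.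
have ex : exists n, `[< walk_of_length e x y n >] by exists n; apply/asboolP.
case: (ex_minnP ex) => m /asboolP wm minm; rewrite /graph_dist.
case: xgetP => [_ -> //|/(_ m) []].
by split=> // k /asboolP; exact: minm.
Qed.

Lemma graph_dist_walk x y : walk_of_length e x y (d x y).
Proof. by case: (graph_distP x y). Qed.

Lemma graph_dist_le x y n : walk_of_length e x y n -> (d x y <= n)%N.
Proof. by case: (graph_distP x y) => _; apply. Qed.

Lemma graph_distxx x : d x x = 0%N.
Proof. by apply/eqP; rewrite -leqn0; apply: graph_dist_le; exists [::]. Qed.

Lemma graph_distC x y : d x y = d y x.
Proof.
wlog suff: x y / (d x y <= d y x)%N.
  by move=> h; apply/eqP; rewrite eqn_leq !h.
have [p [ep <- <-]] := graph_dist_walk y x.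
apply: graph_dist_le; exists (rev (belast y p)); split.
- rewrite rev_path; apply: sub_path ep => a b; by rewrite sym_e.
- by case: p {ep} => //= z p; rewrite rev_cons last_rcons.
- by rewrite size_rev size_belast.
Qed.

Lemma graph_dist_triangle y x z : (d x z <= d x y + d y z)%N.
Proof.
have [p [ep lp <-]] := graph_dist_walk x y.
have [q [eq lq <-]] := graph_dist_walk y z.
apply: graph_dist_le; exists (p ++ q).
by rewrite cat_path last_cat lp ep eq size_cat.
Qed.

Lemma graph_dist_nth x p m k : path e x p -> (m + k <= size p)%N ->
  (d (nth x (x :: p) m) (nth x (x :: p) (m + k)) <= k)%N.
Proof.
move=> ep; elim: k => [|k IH] mk; first by rewrite addn0 graph_distxx.
have mk' : (m + k <= size p)%N by lia.
apply: leq_trans (graph_dist_triangle (nth x (x :: p) (m + k)) _ _) _.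
suff : (d (nth x (x :: p) (m + k)) (nth x (x :: p) (m + k.+1)) <= 1)%N.
  by have := IH mk'; lia.
apply: graph_dist_le; exists [:: nth x (x :: p) (m + k.+1)]; split=> //=.
by rewrite andbT addnS /=; apply/pathP => //; lia.
Qed.

Lemma shortest_walk_geodesic x p y :
  path e x p -> last x p = y -> size p = d x y -> geodesic_path e x p y.
Proof.
move=> ep lp sp; split=> // m n.
wlog mn : m n / (m <= n)%N => [h|] mp np.
  case: (leqP m n) => [mn|/ltnW nm]; first exact: h.
  by rewrite distnC -(h _ _ nm np mp); exact: graph_distC.
rewrite distnEr//.
have e0 : nth x (x :: p) 0 = x by [].
have ey : nth x (x :: p) (size p) = y by rewrite -lp (last_nth x).
have p1 : (m + (n - m) <= size p)%N by rewrite subnKC.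
have p2 : (n + (size p - n) <= size p)%N by rewrite subnKC.
have := @graph_dist_nth x p 0 m ep mp.
have := graph_dist_nth ep p1; have := graph_dist_nth ep p2.
rewrite add0n !subnKC// e0 ey => h1 h2 h3.
have := graph_dist_triangle (nth x (x :: p) m) x y.
have := graph_dist_triangle (nth x (x :: p) n) (nth x (x :: p) m) y.
rewrite -sp; move: h1 h2 h3; move: (d _ y) (d _ _) (d _ _) (d _ _) => A1 A2 A3 A4.
by lia.
Qed.

Lemma geodesic_exists x y : exists p, path e x p /\ geodesic_path e x p y.
Proof.
have [p [ep lp sp]] := graph_dist_walk x y.
by exists p; split=> //; exact: shortest_walk_geodesic.
Qed.

Lemma geodesic_between x p y z : geodesic_path e x p y -> z \in x :: p ->
  (d x z + d z y = d x y)%N.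
Proof.
move=> [lp gp] zp.
have ey : nth x (x :: p) (size p) = y by rewrite -lp (last_nth x).
have : (index z (x :: p) <= size p)%N by rewrite -ltnS index_mem.
move: (index z _) (nth_index x zp) => i zi ip.
have -> : d x z = i by rewrite -zi (gp 0%N i)// dist0n.
have -> : d z y = (size p - i)%N by rewrite -zi -ey gp// distnEr.
have -> : d x y = size p by rewrite -ey (gp 0%N (size p))// dist0n.
by rewrite subnKC.
Qed.

Lemma graph_interpolation x y t : (t <= d x y)%N ->
  exists2 z, d x z = t & d z y = (d x y - t)%N.
Proof.
have [p [ep [lp gp]]] := geodesic_exists x y.
have ey : nth x (x :: p) (size p) = y by rewrite -lp (last_nth x).
have -> : d x y = size p by rewrite -ey (gp 0%N (size p))// dist0n.
move=> tp; exists (nth x (x :: p) t); first by rewrite (gp 0%N t)// dist0n.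
by rewrite -ey gp// distnEr.
Qed.

(** Any point v between x and y lies on some geodesic, the concatenation of
geodesics from x to v and from v to y, so the geodesic paths can be eliminated
from the thin triangle condition. *)
Lemma graph_thin (R : realType) : hyperbolic_graph R e ->
  exists delta, forall x y z v, (d x v + d v y = d x y)%N ->
  exists2 u, (d v u <= delta)%N &
    (d x u + d u z = d x z \/ d y u + d u z = d y z)%N.
Proof.
move=> [_ [delta delta0 hyp]]; exists (Num.bound delta) => x y z v xvy.
have [p [ep lp sp]] := graph_dist_walk x v.
have [q [eq lq sq]] := graph_dist_walk v y.
have gpq : geodesic_path e x (p ++ q) y.
  apply: shortest_walk_geodesic; first by rewrite cat_path lp ep.
    by rewrite last_cat lp.
  by rewrite size_cat sp sq.
have [r [_ gr]] := geodesic_exists y z.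
have [s [_ gs]] := geodesic_exists z x.
have [hv _ _] := hyp _ _ _ _ _ _ gpq gr gs.
have vpq : v \in x :: p ++ q by rewrite -lp -cat_cons mem_cat mem_last.
have [u urs vu] := hv v vpq.
exists u.
  have := lt_trans vu (archi_boundP (ltW delta0)).
  by rewrite ltr_nat => /ltnW.
case: urs => [/(geodesic_between gr) yu|/(geodesic_between gs) zu]; [by right|left].
by rewrite (graph_distC x u) addnC (graph_distC u z) (graph_distC x z).
Qed.

Variables (nbr : V -> seq V) (k : nat).
Hypothesis mem_nbr : forall x y, e x y -> y \in nbr x.
Hypothesis size_nbr : forall x, (size (nbr x) <= k)%N.

Fixpoint graph_ball n x : seq V :=
  if n is n'.+1 then x :: flatten [seq graph_ball n' y | y <- nbr x] else [:: x].

Fixpoint graph_ball_bound n : nat :=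
  if n is n'.+1 then (k * graph_ball_bound n').+1 else 1.

Lemma mem_graph_ball n x y : (d x y <= n)%N -> y \in graph_ball n x.
Proof.
have [p [ep lp <-]] := graph_dist_walk x y.
elim: n x p ep lp => [|n IH] x [|z p] //=; rewrite ?inE; try by move=> _ -> _; rewrite eqxx.
move=> /andP[xz ep] lp sp; apply/orP; right; apply/flattenP.
exists (graph_ball n z); last exact: IH lp _.
by apply: map_f; exact: mem_nbr.
Qed.

Lemma size_graph_ball n x : (size (graph_ball n x) <= graph_ball_bound n)%N.
Proof.
elim: n x => //= n IH x; rewrite ltnS size_flatten sumnE !big_map.
apply: leq_trans (_ : \sum_(y <- nbr x) graph_ball_bound n <= _)%N.
  by apply: leq_sum.
by rewrite big_const_seq iter_addn_0 count_predT mulnC leq_mul2r size_nbr orbT.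
Qed.

Lemma gram_graph (R : realType) : hyperbolic_graph R e -> V -> exists C : R,
  forall L (F : seq V), (0 < L)%N -> exists2 kappa, gram C kappa &
  {in F &, forall x y, kappa x y =
     L%:R^-1 ^+ 2 * \sum_(i < L) \sum_(j < L) (d x y <= i + j)%N%:R}.
Proof.
move=> /graph_thin[delta thin] o.
exact: (gram_hyperbolic o graph_distxx graph_distC graph_dist_triangle
  graph_interpolation thin mem_graph_ball size_graph_ball).
Qed.

End GraphMetric.

Section Cayley.
Variables (G : groupType) (S : seq G).
Let e := cayley_graph S.

Lemma cayley_sym : symmetric e.
Proof.
move=> x y; rewrite /e /cayley_graph eq_sym; congr (_ && _).
have -> : (y^-1 * x)%g = (x^-1 * y)^-1%g by rewrite invgM invgK.
by rewrite /sym_mem invgK orbC.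
Qed.

Definition cayley_nbr (x : G) : seq G :=
  [seq (x * s)%g | s <- S ++ [seq s^-1%g | s <- S]].

Lemma mem_cayley_nbr x y : e x y -> y \in cayley_nbr x.
Proof.
move=> /andP[_ xy]; rewrite -[y](mulVKg x); apply: (map_f (fun s => (x * s)%g)).
rewrite mem_cat; case/orP: xy => [->//|xy].
by apply/orP; right; rewrite -[(x^-1 * y)%g]invgK map_f.
Qed.

Lemma size_cayley_nbr x : (size (cayley_nbr x) <= 2 * size S)%N.
Proof. by rewrite size_map size_cat size_map addnn mul2n. Qed.

Lemma graph_dist_mull g x y :
  graph_dist e (g * x)%g (g * y)%g = graph_dist e x y.
Proof.
suff h n : walk_of_length e (g * x)%g (g * y)%g n <-> walk_of_length e x y n.
  by rewrite /graph_dist; congr xget; apply/seteqP; split=> m [/h h1 h2];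
    split=> // k /h; exact: h2.
wlog suff : g x y / walk_of_length e x y n ->
    walk_of_length e (g * x)%g (g * y)%g n.
  move=> h; split; last exact: h.
  by move=> /(h g^-1%g); rewrite !mulKg.
move=> [p [ep <- <-]]; exists [seq (g * s)%g | s <- p].
rewrite size_map last_map path_map; split=> //.
apply: sub_path ep => a b; rewrite /e /cayley_graph /=.
by rewrite (inj_eq (mulgI g)) invgM -mulgA mulKg.
Qed.

End Cayley.

(** * The Hilbert space norm *)

Local Open Scope complex_scope.

Section Normc.
Variable R : realType.

Lemma normc_nneg (z : R[i]) : 0 <= normc z.
Proof. by case: z => a b; exact: sqrtr_ge0. Qed.

Lemma normc_real (r : R) : normc r%:C = `|r|.
Proof. by rewrite /= expr0n addr0 sqrtr_sqr. Qed.

Lemma sqr_normc_sum_le (I : finType) (a : I -> R) (z : I -> R[i]) :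
  normc (\sum_i (a i)%:C * z i) ^+ 2 <=
  (\sum_i a i ^+ 2) * (\sum_i normc (z i) ^+ 2).
Proof.
have le1 : normc (\sum_i (a i)%:C * z i) <= \sum_i `|a i| * normc (z i).
  elim/big_ind2 : _ => [|u x v y hu hv|i _]; first by rewrite normc0.
    by apply: le_trans (le_normcD _ _) (lerD hu hv).
  by rewrite normcM normc_real.
apply: (@le_trans _ _ ((\sum_i `|a i| * normc (z i)) ^+ 2)).
  rewrite lerXn2r ?nnegrE ?normc_nneg// sumr_ge0// => i _.
  by rewrite mulr_ge0 ?normc_nneg.
apply: le_trans (cauchy_schwarz_sum _ _) _.
by under eq_bigr do rewrite real_normK ?num_real//.
Qed.
End Normc.

Section EllTwoNorm.
Variables (R : realType) (X : choiceType).
Implicit Types (f g : ell2 R X) (h : X -> R[i]).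

Lemma sqr_normc_ge0 (z : R[i]) : 0 <= normc z ^+ 2.
Proof. exact: sqr_ge0. Qed.

(** The supremum over finite sets commutes with the sum over i because all the
terms are nonnegative; one finite set serves for all i. *)
Lemma square_sum_le_bound n (h : 'I_n -> X -> R[i]) (B : R) :
  (forall s : seq X, uniq s ->
    \sum_(i < n) \sum_(x <- s) normc (h i x) ^+ 2 <= B) ->
  (\sum_(i < n) square_sum (h i) <= B%:E)%E.
Proof.
move=> hB; rewrite /square_sum -esum_sum => [|x i _ _]; last first.
  by rewrite lee_fin sqr_normc_ge0.
apply: ge_ereal_sup => _ [A [finA _] <-].
rewrite fsbig_finite//=; under eq_bigr do rewrite sumEFin.
by rewrite sumEFin lee_fin exchange_big hB// fset_uniq.
Qed.

Lemma square_sumE f : square_sum f = (ell2_norm f ^+ 2)%:E.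
Proof.
have ge0 : (0 <= square_sum f)%E.
  by apply: esum_ge0 => x _; rewrite lee_fin sqr_normc_ge0.
have fin : square_sum f \is a fin_num.
  by rewrite ge0_fin_numE//; case: f {ge0} => f /= /asboolP.
by rewrite /ell2_norm sqr_sqrtr ?fine_ge0// fineK.
Qed.

Lemma finite_sum_le_norm f (s : seq X) : uniq s ->
  \sum_(x <- s) normc (f x) ^+ 2 <= ell2_norm f ^+ 2.
Proof.
move=> us; rewrite -lee_fin -square_sumE -sumEFin.
apply: esum_ge; exists [set` s]%classic; first by split.
by rewrite fsbig_seq.
Qed.

Lemma sum_norm_le_bound n (f : 'I_n -> ell2 R X) (B : R) :
  (forall s : seq X, uniq s ->
    \sum_(i < n) \sum_(x <- s) normc (f i x) ^+ 2 <= B) ->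
  \sum_(i < n) ell2_norm (f i) ^+ 2 <= B.
Proof.
move=> /square_sum_le_bound; rewrite -lee_fin -sumEFin.
by under eq_bigr do rewrite square_sumE.
Qed.

Lemma norm_le_bound f (B : R) :
  (forall s : seq X, uniq s -> \sum_(x <- s) normc (f x) ^+ 2 <= B) ->
  ell2_norm f ^+ 2 <= B.
Proof.
move=> hB; have := @sum_norm_le_bound 1 (fun=> f) B.
by rewrite big_ord1; apply=> s us; rewrite big_ord1 hB.
Qed.

Lemma ell2_norm_ge0 f : 0 <= ell2_norm f.
Proof. exact: sqrtr_ge0. Qed.

Lemma ell2_normZ_le (a : R) f : 0 <= a ->
  ell2_norm (a%:C *: f) <= a * ell2_norm f.
Proof.
move=> a0; rewrite -(@ler_pXn2r _ 2) ?nnegrE ?mulr_ge0 ?ell2_norm_ge0//.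
rewrite exprMn; apply: norm_le_bound => s us.
apply: (@le_trans _ _ (\sum_(x <- s) a ^+ 2 * normc (f x) ^+ 2)).
  apply: ler_sum => x _.
  have -> : (a%:C *: f) x = a%:C * f x by [].
  by rewrite normcM exprMn normc_real real_normK ?num_real.
by rewrite -mulr_sumr ler_wpM2l ?sqr_ge0 ?finite_sum_le_norm.
Qed.

Lemma ell2_sumE (I : Type) (r : seq I) (f : I -> ell2 R X) x :
  (\sum_(i <- r) f i) x = \sum_(i <- r) f i x.
Proof. by elim/big_rec2 : _ => // i u v _ <-. Qed.

Definition ell2_of_seq (s : seq X) (a : X -> R[i]) : ell2 R X :=
  \sum_(y <- s) a y *: ell2_delta R y.

Lemma ell2_of_seqE s a x : uniq s ->
  ell2_of_seq s a x = if x \in s then a x else 0.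
Proof.
move=> us; rewrite /ell2_of_seq ell2_sumE.
have term y : (a y *: ell2_delta R y) x = if y == x then a x else 0.
  have -> : (a y *: ell2_delta R y) x = a y * (x == y)%:R by [].
  rewrite eq_sym.
  by case: eqP => [->|_]; rewrite ?mulr1 ?mulr0.
under eq_bigr do rewrite term.
rewrite -big_mkcond/=; case: ifPn => xs.
  rewrite (big_rem x)//= eqxx big_hasC ?addr0//.
  by apply/hasPn => y; rewrite mem_rem_uniq// inE => /andP[].
by rewrite big_hasC//; apply/hasPn => y ys; apply: contra xs => /eqP <-.
Qed.

Lemma norm_ell2_of_seq s a : uniq s ->
  ell2_norm (ell2_of_seq s a) ^+ 2 <= \sum_(y <- s) normc (a y) ^+ 2.
Proof.
move=> us; apply: norm_le_bound => t ut.
under eq_bigr do rewrite ell2_of_seqE//.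
rewrite (bigID (mem s))/= [X in _ + X]big1 => [|x /negbTE->]; last first.
  by rewrite normc0 expr0n.
rewrite addr0 [leRHS](bigID (mem t))/=.
have -> : \sum_(x <- t | x \in s) normc (if x \in s then a x else 0) ^+ 2 =
    \sum_(x <- s | x \in t) normc (a x) ^+ 2.
  under eq_bigr => x xs do rewrite xs.
  rewrite -[LHS]big_filter -[RHS]big_filter; apply: perm_big; apply: uniq_perm;
    rewrite ?filter_uniq// => x.
  by rewrite !mem_filter andbC.
by rewrite lerDl sumr_ge0// => x _; exact: sqr_normc_ge0.
Qed.

End EllTwoNorm.

(** * Factored kernels are Schur multipliers *)

Section SchurMultiplier.
Variables (R : realType) (X : choiceType).

Lemma operatorE (A : bounded_operator R X) (s : seq X) (a : X -> R[i]) x :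
  A (ell2_of_seq s a) x = \sum_(y <- s) a y * entry A x y.
Proof.
rewrite /ell2_of_seq linear_sum ell2_sumE; apply: eq_bigr => y _.
by rewrite linearZ.
Qed.

Variables (kappa : X -> X -> R) (supp : X -> seq X) (C : R).
Hypothesis uniq_supp : forall x, uniq (supp x).
Hypothesis kappa_supp : forall x y, y \notin supp x -> kappa x y = 0.
Hypothesis C_ge0 : 0 <= C.
Hypothesis gram_kappa : forall F : seq X, exists2 k, gram C k &
  {in F &, forall x y, k x y = kappa x y}.

(** The rows of kappa are finite, so the Schur product can be applied to a
vector by finite sums. *)
Definition schur_fun (A : bounded_operator R X) (v : X -> R[i]) (x : X) : R[i] :=
  \sum_(y <- supp x) (kappa x y)%:C * entry A x y * v y.

Lemma schur_fun_widen A v x (F : seq X) :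
  uniq F -> {subset supp x <= F} ->
  schur_fun A v x = \sum_(y <- F) (kappa x y)%:C * entry A x y * v y.
Proof.
move=> uF sF; rewrite /schur_fun [RHS](bigID (mem (supp x)))/=.
rewrite [X in _ + X]big1 ?addr0 => [|y /kappa_supp->]; last by rewrite !mul0r.
rewrite -[RHS]big_filter; apply: perm_big; apply: uniq_perm;
  rewrite ?filter_uniq// => y.
by rewrite mem_filter; case: (boolP (y \in supp x)) => //= /sF ->.
Qed.

(** On a finite set the Schur product is the sum over a of D_(xi a) A D_(eta a),
where D_f is the diagonal operator f.  The row of the D_(xi a) and the column of
the D_(eta a) have norms at most sqrt C each. *)
Lemma schur_column_bound n (A : 'I_n -> 'I_n -> bounded_operator R X) (M : R) :
  0 <= M ->
  (forall v : 'I_n -> ell2 R X,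
    \sum_i ell2_norm (\sum_j A i j (v j)) ^+ 2 <=
    M * \sum_j ell2_norm (v j) ^+ 2) ->
  forall (v : 'I_n -> ell2 R X) (F : seq X), uniq F ->
    \sum_i \sum_(x <- F) normc (\sum_j schur_fun (A i j) (v j) x) ^+ 2 <=
    C ^+ 2 * M * \sum_j ell2_norm (v j) ^+ 2.
Proof.
move=> M0 hM v F uF.
(* The coordinates in F of the Schur product only involve those of v in F'. *)
pose F' := undup (F ++ flatten [seq supp x | x <- F]).
have uF' : uniq F' by exact: undup_uniq.
have subF x : x \in F -> {subset supp x <= F'}.
  move=> xF y yx; rewrite mem_undup mem_cat; apply/orP; right.
  by apply/flattenP; exists (supp x) => //; exact: map_f.
have FF' x : x \in F -> x \in F' by move=> xF; rewrite mem_undup mem_cat xF.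
have [k [I [xi [eta [kE hxi heta]]]] kF'] := gram_kappa F'.
pose u a j := ell2_of_seq F' (fun y => (eta y a)%:C * v j y).
pose w a i := \sum_j A i j (u a j).
have schurE i x : x \in F ->
    \sum_j schur_fun (A i j) (v j) x = \sum_a (xi x a)%:C * w a i x.
  move=> xF.
  transitivity (\sum_a \sum_j \sum_(y <- F')
      (xi x a)%:C * ((eta y a)%:C * v j y * entry (A i j) x y)); last first.
    apply: eq_bigr => a _; rewrite /w ell2_sumE mulr_sumr.
    by apply: eq_bigr => j _; rewrite operatorE mulr_sumr.
  rewrite [RHS]exchange_big; apply: eq_bigr => j _.
  rewrite [RHS]exchange_big (schur_fun_widen _ _ uF' (subF x xF)).
  apply: eq_big_seq => y yF' /=.
  have <- : k x y = kappa x y by apply: kF' => //; exact: FF'.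
  rewrite kE rmorph_sum !mulr_suml.
  by apply: eq_bigr => a _; rewrite rmorphM; ring.
have step1 : \sum_i \sum_(x <- F) normc (\sum_j schur_fun (A i j) (v j) x) ^+ 2
    <= C * \sum_a \sum_i ell2_norm (w a i) ^+ 2.
  apply: (@le_trans _ _ (\sum_i \sum_(x <- F)
      C * \sum_a normc (w a i x) ^+ 2)).
    apply: ler_sum => i _; rewrite big_seq [leRHS]big_seq.
    apply: ler_sum => x xF; rewrite schurE//.
    apply: le_trans (sqr_normc_sum_le _ _) _; apply: ler_wpM2r => //.
    by apply: sumr_ge0 => a _; exact: sqr_ge0.
  rewrite [X in _ <= C * X]exchange_big/= mulr_sumr; apply: ler_sum => i _.
  rewrite -mulr_sumr ler_wpM2l// exchange_big.
  by apply: ler_sum => a _; exact: finite_sum_le_norm.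
have step2 : \sum_a \sum_i ell2_norm (w a i) ^+ 2 <=
    M * (\sum_a \sum_j ell2_norm (u a j) ^+ 2).
  by rewrite mulr_sumr; apply: ler_sum => a _; exact: hM.
have step3 : \sum_a \sum_j ell2_norm (u a j) ^+ 2 <=
    C * \sum_j ell2_norm (v j) ^+ 2.
  rewrite exchange_big mulr_sumr; apply: ler_sum => j _.
  apply: (@le_trans _ _ (\sum_a \sum_(y <- F')
      eta y a ^+ 2 * normc (v j y) ^+ 2)).
    apply: ler_sum => a _; apply: le_trans (norm_ell2_of_seq _ uF') _.
    apply: ler_sum => y _.
    by rewrite normcM exprMn normc_real real_normK ?num_real.
  rewrite exchange_big.
  apply: (@le_trans _ _ (\sum_(y <- F') C * normc (v j y) ^+ 2)).
    apply: ler_sum => y _ /=; rewrite -mulr_suml.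
    by apply: ler_wpM2r => //; exact: sqr_ge0.
  by rewrite -mulr_sumr ler_wpM2l// finite_sum_le_norm.
apply: le_trans step1 _; rewrite expr2 -!mulrA; apply: ler_wpM2l => //.
apply: le_trans step2 _; rewrite mulrCA; apply: ler_wpM2l => //.
Qed.

Lemma schur_operator A : exists B : bounded_operator R X,
  forall v x, B v x = schur_fun A v x.
Proof.
have [M hM] : exists M : R, forall f, ell2_norm (A f) <= M * ell2_norm f.
  by case: A.
have bound (v : ell2 R X) (F : seq X) : uniq F ->
    \sum_(x <- F) normc (schur_fun A v x) ^+ 2 <=
    C ^+ 2 * M ^+ 2 * ell2_norm v ^+ 2.
  move=> uF; have := @schur_column_bound 1 (fun _ _ => A) (M ^+ 2) (sqr_ge0 M)
    _ (fun=> v) F uF.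
  rewrite !big_ord1; under eq_bigr do rewrite big_ord1.
  apply=> u; rewrite !big_ord1 -exprMn lerXn2r// ?nnegrE ?ell2_norm_ge0//.
  exact: le_trans (ell2_norm_ge0 _) (hM _).
have summable_schur (v : ell2 R X) : schur_fun A v \in square_summable (X := X).
  apply/asboolP; apply: le_lt_trans (ltry (C ^+ 2 * M ^+ 2 * ell2_norm v ^+ 2)).
  have := @square_sum_le_bound R X 1 (fun=> schur_fun A v)
    (C ^+ 2 * M ^+ 2 * ell2_norm v ^+ 2).
  by rewrite big_ord1; apply=> F uF; rewrite big_ord1; exact: bound.
pose f v := Ell2 (summable_schur v).
have lin_f : linear f.
  move=> c u v; apply: val_inj; apply/funext => x /=.
  rewrite -[RHS]/(c * schur_fun A u x + schur_fun A v x) /schur_fun.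
  rewrite mulr_sumr -big_split; apply: eq_bigr => y _.
  set K := _ * entry A x y.
  change (K * (c * u y + v y) = c * (K * u y) + K * v y).
  by ring.
pose lf : {linear ell2 R X -> ell2 R X} :=
  HB.pack f (GRing.isLinear.Build _ _ _ _ f lin_f).
have bdd : exists N : R, forall v, ell2_norm (lf v) <= N * ell2_norm v.
  exists (C * `|M|) => v.
  rewrite -(@ler_pXn2r _ 2) ?nnegrE ?mulr_ge0 ?ell2_norm_ge0//.
  rewrite !exprMn real_normK ?num_real//.
  by apply: norm_le_bound => F uF; exact: bound.
by exists (BoundedOperator bdd).
Qed.

(** The operator norm controls the unit ball only; a vector of norm N is
divided by N + eps rather than by N, which may be 0. *)
Lemma column_norm_contraction n (A : 'I_n -> 'I_n -> bounded_operator R X) :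
  (op_matrix_norm A <= 1)%E -> forall v : 'I_n -> ell2 R X,
  \sum_i ell2_norm (\sum_j A i j (v j)) ^+ 2 <= \sum_j ell2_norm (v j) ^+ 2.
Proof.
move=> hA.
have colE (v : 'I_n -> ell2 R X) :
    column_norm v ^+ 2 = \sum_j ell2_norm (v j) ^+ 2.
  by rewrite sqr_sqrtr// sumr_ge0// => j _; exact: sqr_ge0.
have col0 (v : 'I_n -> ell2 R X) : 0 <= column_norm v by exact: sqrtr_ge0.
have colZ a (v : 'I_n -> ell2 R X) : 0 <= a ->
    column_norm (fun j => a%:C *: v j) <= a * column_norm v.
  move=> a0; rewrite -(@ler_pXn2r _ 2) ?nnegrE ?mulr_ge0//.
  rewrite exprMn !colE mulr_sumr; apply: ler_sum => j _.
  by rewrite -exprMn lerXn2r ?nnegrE ?mulr_ge0 ?ell2_norm_ge0// ell2_normZ_le.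
have unit_ball (v : 'I_n -> ell2 R X) : column_norm v <= 1 ->
    column_norm (fun i => \sum_j A i j (v j)) <= 1.
  move=> v1; rewrite -lee_fin; apply: le_trans hA.
  by apply: ereal_sup_ubound; exists v.
move=> v; rewrite -!colE lerXn2r ?nnegrE//.
apply/ler_addgt0Pr => eps eps0; set t := column_norm v + eps.
have t0 : 0 < t by rewrite ltr_wpDl.
have le1 : column_norm (fun j => (t^-1)%:C *: v j) <= 1.
  apply: le_trans (colZ _ _ _) _; first by rewrite invr_ge0 ltW.
  by rewrite mulrC ler_pdivrMr// mul1r lerDl ltW.
have -> : (fun i => \sum_j A i j (v j)) =
    (fun i => t%:C *: \sum_j A i j ((t^-1)%:C *: v j)).
  apply/funext => i; rewrite scaler_sumr; apply: eq_bigr => j _.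
  by rewrite linearZ scalerA -rmorphM mulfV ?gt_eqF// rmorph1 scale1r.
apply: le_trans (colZ _ _ (ltW t0)) _; rewrite -[leRHS]mulr1.
by apply: ler_wpM2l; [exact: ltW|exact: unit_ball].
Qed.

Lemma schur_cb_norm_le : (schur_cb_norm (fun x y => (kappa x y)%:C) <= C%:E)%E.
Proof.
have [m hm] := choice schur_operator.
have schur_m : is_schur_multiplier (fun x y => (kappa x y)%:C) m.
  move=> A x y; rewrite /entry hm /schur_fun.
  case: (boolP (y \in supp x)) => [yx|/[dup] yx /kappa_supp->].
    rewrite (bigD1_seq y)//= eqxx mulr1 big1 ?addr0// => z /negbTE zy.
    by rewrite zy mulr0.
  rewrite mul0r big_seq big1// => z zx /=; rewrite (_ : _ == _ = false) ?mulr0//.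
  by apply/negbTE; apply: contraNneq yx => <-.
apply: (@le_trans _ _ (map_cb_norm m)).
  by apply: ereal_inf_lbound; exists m.
apply: ge_ereal_sup => _ [n [A [hA ->]]].
apply: ge_ereal_sup => _ [v v1 <-]; rewrite lee_fin.
rewrite -(@ler_pXn2r _ 2) ?nnegrE ?sqrtr_ge0// sqr_sqrtr; last first.
  by apply: sumr_ge0 => i _; exact: sqr_ge0.
apply: sum_norm_le_bound => F uF.
have hM v' : \sum_i ell2_norm (\sum_j A i j (v' j)) ^+ 2 <=
    1 * \sum_j ell2_norm (v' j) ^+ 2.
  by rewrite mul1r; exact: column_norm_contraction.
have := schur_column_bound ler01 hM v uF; rewrite mulr1.
under eq_bigr => i _ do under eq_bigr => x _ do
  (under eq_bigr do rewrite -hm); under eq_bigr => i _ do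
  under eq_bigr => x _ do rewrite -ell2_sumE.
move/le_trans; apply; rewrite -[leRHS]mulr1 ler_wpM2l ?sqr_ge0//.
rewrite -[leLHS]sqr_sqrtr; last by apply: sumr_ge0 => i _; exact: sqr_ge0.
by rewrite exprn_ile1// sqrtr_ge0.
Qed.

End SchurMultiplier.

(** * Averages of indicator functions of balls *)

Section TentFunction.
Variable R : realType.

Definition tent (L D : nat) : R :=
  L%:R^-1 ^+ 2 * \sum_(i < L) \sum_(j < L) (D <= i + j)%N%:R.

Lemma tent_eq0 L D : (2 * L <= D)%N -> tent L D = 0.
Proof.
move=> LD; rewrite /tent big1 ?mulr0// => i _; rewrite big1// => j _.
by rewrite (_ : (_ <= _)%N = false)//; have := ltn_ord i; have := ltn_ord j; lia.
Qed.

(** The defect counts the pairs with i + j < D; both i and j are then below D. *)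
Lemma tent_near1 L D : (0 < L)%N -> `|1 - tent L D| <= D%:R ^+ 2 / L%:R.
Proof.
move=> L0; have L0' : (0 : R) < L%:R by rewrite ltr0n.
have count_lt : (\sum_(i < L) (i < D) <= D)%N.
  case: D => [|D]; first by rewrite big1.
  by apply: (@leq_sum_window (fun i => i < D.+1)%N); lia.
have -> : 1 - tent L D =
    L%:R^-1 ^+ 2 * \sum_(i < L) \sum_(j < L) (i + j < D)%N%:R.
  have total : L%:R^-1 ^+ 2 * \sum_(i < L) \sum_(j < L) 1 = 1 :> R.
    by rewrite !sumr_const !card_ord -mulrnA natrM; field; rewrite gt_eqF.
  rewrite /tent -[X in X - _]total -mulrBr -sumrB; congr (_ * _); apply: eq_bigr => i _.
  rewrite -sumrB; apply: eq_bigr => j _.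
  by rewrite leqNgt; case: (_ < _)%N; rewrite ?subr0 ?subrr.
rewrite ger0_norm; last first.
  by rewrite mulr_ge0 ?sqr_ge0// sumr_ge0// => i _; rewrite sumr_ge0.
have sum_le : \sum_(i < L) \sum_(j < L) (i + j < D)%N%:R <= D%:R ^+ 2 :> R.
  apply: (@le_trans _ _ ((\sum_(i < L) (i < D)) * \sum_(j < L) (j < D))%N%:R).
    rewrite natrM !natr_sum mulr_suml; apply: ler_sum => i _.
    rewrite mulr_sumr; apply: ler_sum => j _.
    by rewrite -natrM ler_nat; lia.
  by rewrite -natrX ler_nat leq_mul.
rewrite mulrC ler_pM ?sqr_ge0// ?sumr_ge0//.
  by move=> i _; rewrite sumr_ge0.
by rewrite expr2 -[leRHS]mulr1 ler_wpM2l ?invr_ge0 ?ler0n// invf_le1// ler1n.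
Qed.

End TentFunction.

Theorem theorem2 (R : realType) (G : groupType) :
  hyperbolic_group R G -> weakly_amenable R G.
Proof.
move=> [S _ hyp]; pose e := cayley_graph S; pose d := graph_dist e.
have conn : connected_graph e by case: hyp.
have [C hC] := gram_graph (@cayley_sym G S) conn (@mem_cayley_nbr G S)
  (@size_cayley_nbr G S) hyp 1%g.
have C0 : 0 <= C.
  have [k [I [xi [eta [_ hxi _]]]] _] := hC 1%N [::] isT.
  by apply: le_trans (hxi 1%g); apply: sumr_ge0 => i _; exact: sqr_ge0.
have d1 (x y : G) : d 1%g (x^-1 * y)%g = d x y.
  by have := graph_dist_mull S x 1%g (x^-1 * y)%g; rewrite mulg1 mulVKg.
pose ball n := graph_ball (cayley_nbr S) n.
have tent0 n x y : y \notin ball (2 * n)%N x -> tent R n (d x y) = 0.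
  move=> yB; apply: tent_eq0; rewrite leqNgt; apply: contra yB => xy.
  by apply: (mem_graph_ball conn (@mem_cayley_nbr G S)); exact: ltnW.
exists C, (fun n g => (tent R n.+1 (d 1%g g))%:C); split=> [n|g|].
- apply: (@sub_finite_set _ _ [set` ball (2 * n.+1)%N 1%g]%classic) => //.
  move=> x /=; case: (boolP (x \in ball (2 * n.+1)%N 1%g)) => // xB.
  by rewrite (tent0 _ _ _ xB) eqxx.
- apply/cvgrPdist_le => eps eps0.
  have [r r0 ->] : exists2 r : R, 0 < r & eps = r%:C.
    case: eps eps0 => r i; rewrite ltcE /= => /andP[/eqP -> r0].
    by exists r.
  near=> n.
  have -> : `|(1 : R[i]^o) - (tent R n.+1 (d 1%g g))%:C| =
      `|1 - tent R n.+1 (d 1%g g)|%:C.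
    by rewrite -normc_real rmorphB rmorph1.
  rewrite lecR; apply: le_trans (@tent_near1 R n.+1 (d 1%g g) isT) _.
  rewrite ler_pdivrMr ?ltr0n// -ler_pdivrMl// mulrC.
  apply: (@le_trans _ _ n%:R); last by rewrite ler_nat.
  near: n; exact: nbhs_infty_ger.
- apply: ge_ereal_sup => _ [n _ <-]; rewrite /group_cb_norm.
  have -> : (fun x y : G => (tent R n.+1 (d 1%g (x^-1 * y)%g))%:C) =
      (fun x y => (tent R n.+1 (d x y))%:C).
    by apply/funext => x; apply/funext => y; rewrite d1.
  apply: (@schur_cb_norm_le R G (fun x y => tent R n.+1 (d x y))
    (fun x => undup (ball (2 * n.+1)%N x))) => //.
  + by move=> x; exact: undup_uniq.
  + by move=> x y; rewrite mem_undup; exact: tent0.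
  + by move=> F; exact: hC.
Unshelve. all: by end_near. Qed.
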